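(* For every not-free, constraint-free and head-consistent NNP program $P$, $$LM(P)=\bigcup_{i\ge 0}NT_P^{\,i}=\mathrm{lfp}(NT_P).$$
   Context: Atoms $\mathcal{A}$; literals $\mathcal{L}=\mathcal{A}\cup\{\neg a:a\in\mathcal{A}\}$; default literals $\mathit{not}\,\ell$; elementary expressions $\mathcal{E}^1=\mathcal{L}\cup\{\mathit{not}\,\ell\}\cup\{\top,\bot\}$; overlined elementary expressions $\overline{x}$ ($x\in\mathcal{E}^1$). Expressions are built with $\bigwedge[\ldots]$, $\bigvee(\ldots)$; body expressions contain no overlines; not-free expressions contain no default literals (plain or overlined). Interpretation: $I\subseteq\mathcal{L}$ with no pair $a,\neg a$; $I\models\top$, $I\not\models\bot$, $I\models\ell$ iff $\ell\in I$, $I\models\overline{x}$ iff $I\not\models x$, connectives as usual; $I=\!\!\!|\,\varphi$ iff $I\not\models\varphi$. Positive elements: $\mathcal{L}\cup\{\bot\}$. $\mathcal{N}$: expressions in which every elementary occurrence is overlined. $\mathcal{H}^+$: smallest set containing $\mathcal{L}\cup\{\bot\}$, closed under $\bigwedge$ of members, and containing $\bigvee(\varphi_1\ldots\varphi_k)$ whenever one $\varphi_i\in\mathcal{H}^+$ and all other $\varphi_j\in\mathcal{N}$. For $H\in\mathcal{H}^+$ and a positive occurrence $h$, $\Delta(H,h)$ is $\bot$ if $H$ is that occurrence, $\Delta(H_i,h)$ if $H=\bigwedge[H_1\ldots H_k]$ with the occurrence in $H_i$, $\bigvee(H_1\ldots\Delta(H_i,h)\ldots H_k)$ if $H=\bigvee(H_1\ldots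 H_k)$ with the occurrence in $H_i$. $H_\Delta=\bigwedge[\bigvee(h_1\,\Delta(H,h_1))\ldots\bigvee(h_k\,\Delta(H,h_k))]$ over all positive occurrences. An NNP program is a finite nonempty set of rules $H\leftarrow B$, $B$ a body expression, $H\in\mathcal{H}^+$; it is not-free if all $B,H$ are not-free, constraint-free if no head has a positive occurrence of $\bot$, head-consistent if its positive head occurrences $h\neq\bot$ contain no pair $a,\neg a$. $I$ is a model of $P$ if for every rule $H\leftarrow B$: $I\not\models B$, or for each conjunct $\bigvee(h\,\Delta)$ of $H_\Delta$, $I$ does not falsify $\Delta$ or $h\in I$. $LM(P)$ is the least model (the unique minimal model). $NT_P(I)=\{h:(H\leftarrow B)\in P,\ \bigvee(h\,\Delta)\text{ conjunct of }H_\Delta,\ I\models B,\ I=\!\!\!|\,\Delta\}$; $NT_P^0=\emptyset$, $NT_P^{i+1}=NT_P(NT_P^i)$; $\mathrm{lfp}(NT_P)$ is the smallest $I$ with $NT_P(I)\subseteq I$. *)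

(* Defs.v *)
From Stdlib Require List.
From mathcomp Require Import all_boot.
From mathcomp Require Import boolp classical_sets functions cardinality.

Set Implicit Arguments.
Unset Strict Implicit.
Unset Printing Implicit Defensive.

Local Open Scope classical_set_scope.

Inductive literal (A : Type) : Type :=
| Pos of A
| Neg of A.

Inductive elem (A : Type) : Type :=
| Lit of literal A
| Not of literal A    (* default literal [not l] *)
| Top
| Bot.
Arguments Top {A}.
Arguments Bot {A}.

(* Conjunctions and disjunctions have arbitrary finite arity; the empty ones
   are read as truth and falsity respectively. *)
Inductive expr (A : Type) : Type :=
| El of elem A
| Over of elem A      (* overlined elementary expression *)
| And of seq (expr A)
| Or of seq (expr A).

(* [every_occ p e]: each elementary occurrence [x] in [e] satisfies [p o x],
   where [o] tells whether the occurrence is overlined. *)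
Fixpoint every_occ (A : Type) (p : bool -> elem A -> bool) (e : expr A) : bool :=
  match e with
  | El x => p false x
  | Over x => p true x
  | And s | Or s => all (every_occ p) s
  end.

Definition is_default (A : Type) (x : elem A) : bool :=
  if x is Not _ then true else false.

Definition is_positive (A : Type) (x : elem A) : bool :=
  match x with Lit _ | Bot => true | _ => false end.

Definition body_expr (A : Type) (e : expr A) : bool :=
  every_occ (fun o _ => ~~ o) e.

Definition not_free_expr (A : Type) (e : expr A) : bool :=
  every_occ (fun _ x => ~~ is_default x) e.

(* The class N. *)
Definition all_overlined (A : Type) (e : expr A) : bool :=
  every_occ (fun o _ => o) e.

Inductive Hplus (A : Type) : expr A -> Prop :=
| Hplus_elem x : is_positive x -> Hplus (El x)
| Hplus_and s : (forall e, List.In e s -> Hplus e) -> Hplus (And s)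
| Hplus_or s1 e s2 : all (@all_overlined A) s1 -> Hplus e ->
    all (@all_overlined A) s2 -> Hplus (Or (s1 ++ e :: s2)).

(* Sets of literals are sets of elementary expressions included in
   [range Lit], so that NT, whose values may contain Bot for programs that are
   not constraint-free, acts on a single type. *)
Definition interpretation (A : Type) (I : set (elem A)) : Prop :=
  I `<=` range (@Lit A) /\ forall a, ~ (I (Lit (Pos a)) /\ I (Lit (Neg a))).

Definition sat_elem (A : Type) (I : set (elem A)) (x : elem A) : Prop :=
  match x with
  | Lit l => I (Lit l)
  | Not l => ~ I (Lit l)
  | Top => True
  | Bot => False
  end.

Fixpoint sat (A : Type) (I : set (elem A)) (e : expr A) : Prop :=
  match e with
  | El x => sat_elem I x
  | Over x => ~ sat_elem I x
  | And s => foldr and True (map (sat I) s)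
  | Or s => foldr or False (map (sat I) s)
  end.

Definition falsifies (A : Type) (I : set (elem A)) (e : expr A) : Prop :=
  ~ sat I e.

(* The positive occurrences of [e], left to right: each one is given by its
   path from the root (a list of argument positions) and its element. *)
Fixpoint pos_occs (A : Type) (e : expr A) : seq (seq nat * elem A) :=
  match e with
  | El x => if is_positive x then [:: ([::], x)] else [::]
  | Over _ => [::]
  | And s | Or s =>
      flatten [seq [seq (c.1 :: o.1, o.2) | o <- c.2]
              | c <- zip (iota 0 (size s)) (map (@pos_occs A) s)]
  end.

(* Delta(H, h) for the occurrence at path [p]; the value on a list that is not
   a path of [H] is irrelevant. *)
Fixpoint Delta (A : Type) (H : expr A) (p : seq nat) {struct p} : expr A :=
  match p, H with
  | i :: p', And s => Delta (nth (El Bot) s i) p'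
  | i :: p', Or s =>
      Or (set_nth (El Bot) s i (Delta (nth (El Bot) s i) p'))
  | _, _ => El Bot
  end.

Definition H_Delta (A : Type) (H : expr A) : expr A :=
  And [seq Or [:: El o.2; Delta H o.1] | o <- pos_occs H].

Definition conjunct_of (A : Type) (c e : expr A) : Prop :=
  if e is And s then List.In c s else False.

Record rule (A : Type) : Type := Rule { head : expr A; body : expr A }.

Definition nnp_program (A : Type) (P : set (rule A)) : Prop :=
  [/\ finite_set P, P !=set0 &
      forall r, P r -> body_expr (body r) /\ Hplus (head r)].

Definition not_free (A : Type) (P : set (rule A)) : Prop :=
  forall r, P r -> not_free_expr (body r) /\ not_free_expr (head r).

Definition pos_head_elems (A : Type) (P : set (rule A)) : set (elem A) :=
  [set h | exists2 r, P r & exists p, List.In (p, h) (pos_occs (head r))].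

Definition constraint_free (A : Type) (P : set (rule A)) : Prop :=
  ~ pos_head_elems P Bot.

Definition head_consistent (A : Type) (P : set (rule A)) : Prop :=
  forall a, ~ (pos_head_elems P (Lit (Pos a)) /\ pos_head_elems P (Lit (Neg a))).

Definition model (A : Type) (P : set (rule A)) (I : set (elem A)) : Prop :=
  interpretation I /\
  forall r, P r ->
    ~ sat I (body r) \/
    forall h D, conjunct_of (Or [:: El h; D]) (H_Delta (head r)) ->
      ~ falsifies I D \/ I h.

Definition NT (A : Type) (P : set (rule A)) (I : set (elem A)) : set (elem A) :=
  [set h | exists r D, [/\ P r, conjunct_of (Or [:: El h; D]) (H_Delta (head r)),
                           sat I (body r) & falsifies I D]].

Definition NT_iter (A : Type) (P : set (rule A)) (i : nat) : set (elem A) :=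
  iter i (NT P) set0.

Definition is_smallest (T : Type) (C : set (set T)) (X : set T) : Prop :=
  C X /\ forall Y, C Y -> X `<=` Y.

Definition is_least_model (A : Type) (P : set (rule A)) (M : set (elem A)) : Prop :=
  is_smallest [set I | model P I] M.

Definition is_lfp_NT (A : Type) (P : set (rule A)) (M : set (elem A)) : Prop :=
  is_smallest [set I | interpretation I /\ NT P I `<=` I] M.

(* Main.v *)
(* Satisfaction of a not-free body and falsification of a not-free [Delta]
   only depend, when they hold, on the membership of finitely many literals.
   Hence [NT P] is monotone and continuous, and its iterates from the empty set
   build its least prefixed point; being made of head occurrences, that set is
   an interpretation.  The models of [P] are exactly the interpretations which
   are prefixed points of [NT P]. *)
Require Import Defs.
From mathcomp Require Import all_boot.
From mathcomp Require Import boolp classical_sets functions cardinality.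

Set Implicit Arguments.
Unset Strict Implicit.
Unset Printing Implicit Defensive.

Local Open Scope classical_set_scope.

(** * Membership in lists over an arbitrary type, without decidable equality *)

Section ListIn.
Variables (T U : Type).
Implicit Types (s : seq T) (x : T).

Lemma In_cat s1 s2 x :
  List.In x (s1 ++ s2) <-> List.In x s1 \/ List.In x s2.
Proof. elim: s1 => [|y s1 IH] /=; tauto. Qed.

Lemma In_map (f : T -> U) s y :
  List.In y (map f s) <-> exists2 x, y = f x & List.In x s.
Proof.
elim: s => [|z s IH] /=; first by split=> // -[].
rewrite IH; split=> [[<-|[x yE sx]]|[x yE [zx|sx]]].
- by exists z; auto.
- by exists x; auto.
- by left; rewrite zx.
- by right; exists x.
Qed.

Lemma In_flatten (ss : seq (seq T)) x :
  List.In x (flatten ss) <-> exists2 s, List.In s ss & List.In x s.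
Proof.
elim: ss => [|t ss IH] /=; first by split=> // -[].
rewrite In_cat; split=> [[tx|/IH[s ss_s sx]]|[s [<-|ss_s] sx]].
- by exists t; auto.
- by exists s; auto.
- by left.
- by right; apply/IH; exists s.
Qed.

Lemma In_all (p : pred T) s : all p s <-> forall x, List.In x s -> p x.
Proof.
elim: s => [|y s IH] //=; split=> [/andP[py /IH ps] x [<-//|]|ps]; first exact: ps.
by apply/andP; split; [apply: ps; left|apply/IH => x sx; apply: ps; right].
Qed.

Lemma In_nth x0 s i : i < size s -> List.In (nth x0 s i) s.
Proof. by elim: s i => [|y s IH] [|i] //= lt_is; [left|right; apply: IH]. Qed.

(** The offset [m] is kept free for the induction on [s]; [pos_occs] uses [m = 0]. *)
Lemma In_zip_iota x0 m s i x :
  List.In (i, x) (zip (iota m (size s)) s) ->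
  exists j, [/\ i = m + j, j < size s & x = nth x0 s j].
Proof.
elim: s m => [|y s IH] m //= [[<- <-]|/IH[j [-> lt_js ->]]].
  by exists 0; rewrite addn0.
by exists j.+1; rewrite addnS.
Qed.

Lemma foldr_andP (Q : T -> Prop) s :
  foldr and True (map Q s) <-> forall x, List.In x s -> Q x.
Proof.
elim: s => [|y s IH] //=; rewrite IH.
by split=> [[Qy Qs] x [<-//|]|Qs]; [exact: Qs|split=> [|x sx]; apply: Qs; auto].
Qed.

Lemma foldr_orP (Q : T -> Prop) s :
  foldr or False (map Q s) <-> exists2 x, List.In x s & Q x.
Proof.
elim: s => [|y s IH] /=; first by split=> // -[].
rewrite IH; split=> [[Qy|[x sx Qx]]|[x [<-|sx] Qx]].
- by exists y; auto.
- by exists x; auto.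
- by left.
- by right; exists x.
Qed.

End ListIn.

(** * Negation, finite support and positive occurrences of expressions *)

Section Expressions.
Variable A : Type.
Implicit Types (e H D : expr A) (I J : set (elem A)) (x h : elem A).

(** Arguments are nested in a [seq], so a connective needs the hypothesis for every listed argument;
    the inner inductions on [s] keep the calls of [IH] structural. *)
Lemma expr_In_ind (Q : expr A -> Prop) :
  (forall x, Q (El x)) -> (forall x, Q (Over x)) ->
  (forall s, (forall e, List.In e s -> Q e) -> Q (And s)) ->
  (forall s, (forall e, List.In e s -> Q e) -> Q (Or s)) ->
  forall e, Q e.
Proof.
move=> QEl QOver QAnd QOr; fix IH 1 => -[x|x|s|s]; [exact: QEl|exact: QOver|apply: QAnd|apply: QOr].
- by elim: s => [|e s IHs] e' /= []; [move=> <-; exact: IH|exact: IHs].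
- by elim: s => [|e s IHs] e' /= []; [move=> <-; exact: IH|exact: IHs].
Qed.

Lemma every_occ_sub2 (p q r : bool -> elem A -> bool) e :
  (forall o x, p o x -> q o x -> r o x) ->
  every_occ p e -> every_occ q e -> every_occ r e.
Proof.
by move=> pqr; elim/expr_In_ind: e => [x|x|s IH|s IH] /=; try exact: pqr;
   move=> /In_all ps /In_all qs; apply/In_all => e se; apply: IH; auto.
Qed.

(** De Morgan negation: falsifying a [Delta] becomes satisfying an expression, so that one support
    lemma serves both bodies and [Delta]. *)
Fixpoint dual e : expr A :=
  match e with
  | El x => Over x
  | Over x => El x
  | And s => Or (map dual s)
  | Or s => And (map dual s)
  end.

Lemma sat_dual I e : sat I (dual e) <-> falsifies I e.
Proof.
rewrite /falsifies; elim/expr_In_ind: e => [x|x|s IH|s IH] /=.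
- by [].
- by split=> [? //|/contrapT].
- rewrite foldr_orP foldr_andP; split=> [[_ /In_map[e -> se] /(IH e se) ne] /(_ e se)//|].
  move=> /existsNP[e /not_implyP[se ne]].
  by exists (dual e); [apply/In_map; exists e|apply/IH].
- rewrite foldr_orP foldr_andP; split=> [ds [e se]|ns _ /In_map[e -> se]].
    by apply/IH => //; apply: ds; apply/In_map; exists e.
  by apply/IH => // ne; apply: ns; exists e.
Qed.

Lemma every_occ_dual (p : bool -> elem A -> bool) e :
  every_occ p (dual e) = every_occ (fun o x => p (~~ o) x) e.
Proof.
elim/expr_In_ind: e => [x|x|s IH|s IH] //=; rewrite all_map;
  elim: s IH => [|e s IHs] IH //=; rewrite IH /=; auto; rewrite IHs // => *;
  by apply: IH; right.
Qed.

(** Polarities under which truth survives enlarging the interpretation: an overlined default literal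
    is a double negation, hence acts as a literal. *)
Definition monotone_occ (o : bool) x : bool :=
  match x with Lit _ => ~~ o | Not _ => o | _ => true end.

(** The list [t] is a finite certificate: a conjunction concatenates those of its arguments, a
    disjunction keeps that of one true argument. *)
Lemma sat_support I e : every_occ monotone_occ e -> sat I e ->
  exists2 t : seq (elem A), (forall x, List.In x t -> I x) &
    forall J, (forall x, List.In x t -> J x) -> sat J e.
Proof.
elim/expr_In_ind: e => [[l|l||]|[l|l||]|s IH|s IH] //=.
- by move=> _ Il; exists [:: Lit l] => [x [<-|]|J] //; apply; left.
- by move=> _ _; exists [::].
- move=> _ /contrapT Il; exists [:: Lit l] => [x [<-|]|J Jt] //.
  by apply; apply: Jt; left.
- by move=> _ _; exists [::] => // J _ [].
- elim: s IH => [|e s IHs] IH /=; first by exists [::].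
  move=> /andP[me ms] [Ie Is].
  have [t It te] := IH e (or_introl erefl) me Ie.
  have [u Iu us] := IHs (fun e' se' => IH e' (or_intror se')) ms Is.
  exists (t ++ u) => [x /In_cat[/It|/Iu]//|J Jtu].
  by split; [apply: te|apply: us] => x xt; apply: Jtu; apply/In_cat; auto.
- move=> /In_all ms /foldr_orP[e se Ie].
  have [t It te] := IH e se (ms e se) Ie.
  by exists t => // J Jt; apply/foldr_orP; exists e => //; apply: te.
Qed.

Lemma pos_occs_nil e : all_overlined e -> pos_occs e = [::].
Proof.
(* The start of [iota] is generalised because it shifts along the list. *)
elim/expr_In_ind: e => [x|x|s IH|s IH] //=; move: 0 => m;
  elim: s m IH => [|e s IHs] m IH //= /andP[oe os];
  by rewrite (IH e (or_introl erefl) oe) IHs // => e' se'; apply: IH; right.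
Qed.

Lemma In_pos_occs_seq (s : seq (expr A)) p h :
  List.In (p, h) (flatten [seq [seq (c.1 :: o.1, o.2) | o <- c.2]
    | c <- zip (iota 0 (size s)) (map (@pos_occs A) s)]) ->
  exists i p', [/\ p = i :: p', i < size s &
    List.In (p', h) (pos_occs (nth (El Bot) s i))].
Proof.
move=> /In_flatten[_ /In_map[[i o] -> i_o] /In_map[[p' h'] [-> ->]]] /=.
rewrite -(size_map (@pos_occs A)) in i_o.
have [j [-> lt_js ->]] := In_zip_iota [::] i_o.
rewrite size_map in lt_js; rewrite (nth_map (El Bot)) // => hp'.
by exists j, p'.
Qed.

Lemma pos_occs_positive e p h : List.In (p, h) (pos_occs e) -> is_positive h.
Proof.
elim/expr_In_ind: e p => [x|x|s IH|s IH] p //=.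
- by case: ifP => // px [[_ <-]|].
- by move=> /In_pos_occs_seq[i [p' [_ lt_is]]]; apply: IH; apply: In_nth.
- by move=> /In_pos_occs_seq[i [p' [_ lt_is]]]; apply: IH; apply: In_nth.
Qed.

Lemma set_nth_middle (T : Type) (x0 x y : T) s1 s2 :
  set_nth x0 (s1 ++ x :: s2) (size s1) y = s1 ++ y :: s2.
Proof. by elim: s1 => //= z s1 ->. Qed.

Lemma no_pos_occs_nth s i p h : all (@all_overlined A) s -> i < size s ->
  ~ List.In (p, h) (pos_occs (nth (El Bot) s i)).
Proof.
by move=> /In_all os lt_is; rewrite pos_occs_nil //; apply: os; apply: In_nth.
Qed.

(** Members of N have no positive occurrence, so the path must enter [e]; the [set_nth] in [Delta]
    therefore replaces exactly that disjunct. *)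
Lemma In_pos_occs_middle s1 e s2 i p h :
  all (@all_overlined A) s1 -> all (@all_overlined A) s2 ->
  i < size (s1 ++ e :: s2) ->
  List.In (p, h) (pos_occs (nth (El Bot) (s1 ++ e :: s2) i)) ->
  i = size s1 /\ List.In (p, h) (pos_occs e).
Proof.
move=> o1 o2; have [lt_i _|le_i] := ltnP i (size s1).
  by rewrite nth_cat lt_i => /(no_pos_occs_nth o1 lt_i).
rewrite -(subnKC le_i) size_cat ltn_add2l nth_cat [size s1 + _ < _]ltnNge leq_addr addKn /=.
case: (i - size s1) => [|j] /=; first by rewrite addn0.
by move=> lt_j /(no_pos_occs_nth o2 lt_j).
Qed.

(* In [Delta H p] the traced positive occurrence has become [Bot], and every
   other occurrence is overlined. *)
Lemma Delta_antitone H p h : Hplus H -> not_free_expr H ->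
  List.In (p, h) (pos_occs H) ->
  every_occ (fun o x => monotone_occ (~~ o) x) (Delta H p).
Proof.
move=> HH; elim: HH p => [x px p|s _ IH p|s1 e s2 o1 _ IH o2 p].
- by rewrite /= px => _ [[<- _]|].
- move=> nf /In_pos_occs_seq[i [p' [-> lt_is hp']]] /=; move/In_all: nf => nf.
  by have si := In_nth (El Bot) lt_is; apply: (IH _ si p' (nf _ si) hp').
- move=> nf /In_pos_occs_seq[i [p' [-> lt_is]]].
  case/(In_pos_occs_middle o1 o2 lt_is) => -> hp' /=.
  rewrite nth_cat ltnn subnn set_nth_middle all_cat /=.
  (* Among overlined elements only default literals have the wrong polarity, and the head is
     not-free. *)
  have over s : all (@all_overlined A) s -> all (@not_free_expr A) s ->
      all (every_occ (fun o x => monotone_occ (~~ o) x)) s.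
    move=> /In_all os /In_all ns; apply/In_all => e' se'.
    by apply: every_occ_sub2 (os e' se') (ns e' se') => -[] // -[].
  move: nf; rewrite /not_free_expr /= all_cat /= => /and3P[n1 ne n2].
  by rewrite !over // (IH p').
Qed.

Lemma conjunct_HDelta H h D : conjunct_of (Or [:: El h; D]) (H_Delta H) <->
  exists2 p, List.In (p, h) (pos_occs H) & D = Delta H p.
Proof.
rewrite /= In_map; split=> [[[p h'] [-> ->] hp]|[p hp ->]]; first by exists p.
by exists (p, h).
Qed.

End Expressions.

(** * The operator [NT P] and its iterates *)

Section Programs.
Variables (A : Type) (P : set (rule A)).
Implicit Types I J : set (elem A).

(** Classically, the disjunctions in [model] are the implications that make up the inclusion. *)
Lemma model_NT I : model P I <-> interpretation I /\ NT P I `<=` I.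
Proof.
split=> -[intI mI]; split=> //.
  move=> h [r [D [Pr cD sB fD]]].
  by case: (mI r Pr) => [//|/(_ h D cD)[]].
move=> r Pr; have [sB|] := pselect (sat I (body r)); [right=> h D cD|by left].
by have [fD|] := pselect (falsifies I D); [right; apply: mI; exists r, D|left].
Qed.

Lemma NT_pos_head I : NT P I `<=` pos_head_elems P.
Proof.
move=> h [r [D [Pr /conjunct_HDelta[p hp _] _ _]]].
by exists r => //; exists p.
Qed.

(** Without [Bot], the only positive elements are literals; head-consistency excludes complementary
    pairs. *)
Lemma head_interpretation I : constraint_free P -> head_consistent P ->
  I `<=` pos_head_elems P -> interpretation I.
Proof.
move=> cfP hcP IP; split=> [x Ix|a [Ip In]]; last by apply: (hcP a); split; apply: IP.
have := IP x Ix; have [r _ [p /pos_occs_positive]] := IP x Ix.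
by case: x Ix => [l||_|_] // _ _ _; exists l.
Qed.

Hypotheses (nnpP : nnp_program P) (nfP : not_free P).

(** The same rule fires in [J], by concatenating the certificates of its body and of [dual D]. *)
Lemma NT_support I h : NT P I h ->
  exists2 t : seq (elem A), (forall x, List.In x t -> I x) &
    forall J, (forall x, List.In x t -> J x) -> NT P J h.
Proof.
move=> [r [D [Pr cD sB /sat_dual fD]]].
case: nnpP => _ _ /(_ r Pr) [bB HH]; have [nfB nfH] := nfP Pr.
have mB : every_occ (@monotone_occ A) (body r).
  by apply: every_occ_sub2 bB nfB => -[] // -[].
have [p hp eD] := (conjunct_HDelta _ _ _).1 cD.
have mD : every_occ (@monotone_occ A) (dual D).
  by rewrite every_occ_dual eD; apply: Delta_antitone hp.
have [t It tB] := sat_support mB sB; have [u Iu uD] := sat_support mD fD.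
exists (t ++ u) => [x /In_cat[/It|/Iu]//|J Jtu].
exists r, D; split=> //; first by apply: tB => x xt; apply: Jtu; apply/In_cat; left.
by apply/sat_dual; apply: uD => x xu; apply: Jtu; apply/In_cat; right.
Qed.

Lemma NT_mono I J : I `<=` J -> NT P I `<=` NT P J.
Proof. by move=> IJ h /NT_support[t It]; apply=> x /It /IJ. Qed.

Lemma NT_iter_leq m n : m <= n -> NT_iter P m `<=` NT_iter P n.
Proof.
elim: m n => [|m IH] [|n] // mn; try exact: sub0set.
by apply: NT_mono; apply: IH.
Qed.

(** As the iterates increase, a finite certificate for [h] lies in a single one; the next iterate
    then contains [h]. *)
Lemma NT_iter_prefixed : NT P (\bigcup_i NT_iter P i) `<=` \bigcup_i NT_iter P i.
Proof.
move=> h /NT_support[t tU tN].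
suff [n tn] : exists n, forall x, List.In x t -> NT_iter P n x by exists n.+1 => //; apply: tN.
elim: t tU {tN} => [|y t IH] tU; first by exists 0.
have [n tn] := IH (fun x tx => tU x (or_intror tx)).
have [m _ ym] := tU y (or_introl erefl).
exists (maxn m n) => x /= [<-|/tn].
- by apply: NT_iter_leq ym; apply: leq_maxl.
- by apply: NT_iter_leq; apply: leq_maxr.
Qed.

Lemma NT_iter_least J : NT P J `<=` J -> \bigcup_i NT_iter P i `<=` J.
Proof.
move=> NJ; apply: bigcup_sub => i _; elim: i => [|i IH] //=.
by apply: subset_trans NJ; apply: NT_mono.
Qed.

End Programs.

Theorem theorem4 (A : Type) (P : set (rule A)) :
  nnp_program P -> not_free P -> constraint_free P -> head_consistent P ->
  exists LM lfp : set (elem A),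
    [/\ is_least_model P LM, is_lfp_NT P lfp,
        LM = \bigcup_i NT_iter P i & \bigcup_i NT_iter P i = lfp].
Proof.
move=> nnpP nfP cfP hcP.
set U := \bigcup_i NT_iter P i.
have intU : interpretation U.
  apply: head_interpretation cfP hcP _.
  (* Iterate 0 is empty; every later one is a value of [NT P], hence made of head elements. *)
  by apply: bigcup_sub => -[|i] _ //=; apply: NT_pos_head.
have NU : NT P U `<=` U by apply: NT_iter_prefixed.
(* By [model_NT], both minimality claims reduce to [U] lying below every prefixed point. *)
exists U, U; split=> //; split=> //.
- exact/model_NT.
- by move=> Y /model_NT[_]; apply: NT_iter_least.
- by move=> Y [_]; apply: NT_iter_least.
Qed.
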